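(* Let $K_1\subseteq K=\{1,\dots,d_z\}$, $K_2=K\setminus K_1$, and let $J_1,J_2$ be the associated control index sets. For $\boldsymbol{\chi}=(\boldsymbol{x}_1,\boldsymbol{x}_2,\boldsymbol{y}_{J_1},\boldsymbol{y}_{J_2},\boldsymbol{z}_{K_1},\boldsymbol{z}_{K_2})$ with $\boldsymbol{x}_1,\boldsymbol{x}_2\in\mathbb{R}^{d_x}$, $\boldsymbol{y}_{J_i}\in\mathbb{R}^{|J_i|}$, $\boldsymbol{z}_{K_i}\in\mathbb{R}^{|K_i|}$ and $w\in\mathbb{R}$, consider the constraints $$\begin{aligned} &w\ge\boldsymbol{x}_2^\top\boldsymbol{Q}_2\boldsymbol{x}_2+\sum_{i=1}^2\big(\boldsymbol{y}_{J_i}^\top\boldsymbol{R}_{J_i}\boldsymbol{y}_{J_i}+\boldsymbol{z}_{K_i}^\top\boldsymbol{S}_{K_i}\boldsymbol{z}_{K_i}\big),\\ &\boldsymbol{x}_2=\boldsymbol{A}\boldsymbol{x}_1+\boldsymbol{B}_{J_1}\boldsymbol{y}_{J_1}+\boldsymbol{B}_{J_2}\boldsymbol{y}_{J_2}+\boldsymbol{C}_{K_1}\boldsymbol{z}_{K_1}+\boldsymbol{C}_{K_2}\boldsymbol{z}_{K_2},\\ &\boldsymbol{G}_{J_i}\boldsymbol{z}_{K_i}\le\boldsymbol{y}_{J_i}\le\boldsymbol{H}_{J_i}\boldsymbol{z}_{K_i}\ (i=1,2),\qquad \boldsymbol{\ell}_t\le\boldsymbol{x}_t\le\boldsymbol{u}_t\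 (t=1,2),\\ &\mathbf{1}^\top\boldsymbol{z}_{K_1}+\mathbf{1}^\top\boldsymbol{z}_{K_2}\le1, \end{aligned}\qquad( * )$$ and write $\lambda=\mathbf{1}^\top\boldsymbol{z}_{K_1}$. (i) If $(\boldsymbol{\chi},w)$ satisfies $( * )$ and $\boldsymbol{z}_{K_i}\in\{0,1\}^{|K_i|}$ for $i=1,2$, then the following eight (componentwise) inequalities hold: (A) $(1-\lambda)\boldsymbol{\ell}_{\boldsymbol A}+\boldsymbol{B}_{J_2}\boldsymbol{y}_{J_2}+\boldsymbol{C}_{K_2}\boldsymbol{z}_{K_2}\le(1-\lambda)\boldsymbol{u}_2$; (B) $(1-\lambda)\boldsymbol{\ell}_2\le(1-\lambda)\boldsymbol{u}_{\boldsymbol A}+\boldsymbol{B}_{J_2}\boldsymbol{y}_{J_2}+\boldsymbol{C}_{K_2}\boldsymbol{z}_{K_2}$; (C) $(1-\lambda)\boldsymbol{\ell}_{\boldsymbol A}+\boldsymbol{B}_{J_2}\boldsymbol{y}_{J_2}+\boldsymbol{C}_{K_2}\boldsymbol{z}_{K_2}\le\boldsymbol{x}_2-\lambda\boldsymbol{\ell}_2$; (D) $\boldsymbol{x}_2-\boldsymbol{B}_{J_2}\boldsymbol{y}_{J_2}-\boldsymbol{C}_{K_2}\boldsymbol{z}_{K_2}\le\lambda\boldsymbol{u}_2+(1-\lambda)\boldsymbol{u}_{\boldsymbol A}$; (E) $\boldsymbol{A}\boldsymbol{x}_1+\boldsymbol{B}_{J_2}\boldsymbol{y}_{J_2}+\boldsymbol{C}_{K_2}\boldsymbol{z}_{K_2}\ge\lambda\boldsymbol{\ell}_{\boldsymbol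 A}+(1-\lambda)\boldsymbol{\ell}_2$; (F) $\boldsymbol{A}\boldsymbol{x}_1+\boldsymbol{B}_{J_2}\boldsymbol{y}_{J_2}+\boldsymbol{C}_{K_2}\boldsymbol{z}_{K_2}\le\lambda\boldsymbol{u}_{\boldsymbol A}+(1-\lambda)\boldsymbol{u}_2$; (G) $\lambda\boldsymbol{u}_2\ge\boldsymbol{B}_{J_1}\boldsymbol{y}_{J_1}+\boldsymbol{C}_{K_1}\boldsymbol{z}_{K_1}+\lambda\boldsymbol{\ell}_{\boldsymbol A}$; (H) $\boldsymbol{B}_{J_1}\boldsymbol{y}_{J_1}+\boldsymbol{C}_{K_1}\boldsymbol{z}_{K_1}+\lambda\boldsymbol{u}_{\boldsymbol A}\ge\lambda\boldsymbol{\ell}_2$. (ii) Moreover, if $(\boldsymbol{\chi},w)$ satisfies $( * )$ with $\boldsymbol{z}_{K_i}\in[0,1]^{|K_i|}$ for $i=1,2$, satisfies (A)–(H), and $\lambda<1$, then the problem $$\sum_{i=1}^{d_x}\ \min_{\sigma_i\in\mathbb{R}}\ \big\{q_i(x_{2,i}-\sigma_i)^2:\ \ell(\boldsymbol{\chi})_i\le\sigma_i\le u(\boldsymbol{\chi})_i\big\}$$ is feasible, where $q_i$ is the $i$-th diagonal entry of $\boldsymbol{Q}_2$ and, with $\boldsymbol{\beta}=\dfrac{\boldsymbol{B}_{J_2}\boldsymbol{y}_{J_2}+\boldsymbol{C}_{K_2}\boldsymbol{z}_{K_2}}{1-\lambda}$ and max/min taken componentwise, $$\boldsymbol{\ell}(\boldsymbol{\chi})=\max\Big\{\boldsymbol{\ell}_{\boldsymbol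 A}+\boldsymbol{\beta},\ \boldsymbol{\ell}_2,\ \frac{\boldsymbol{A}\boldsymbol{x}_1-\lambda\boldsymbol{u}_{\boldsymbol A}}{1-\lambda}+\boldsymbol{\beta},\ \frac{\boldsymbol{x}_2-\lambda\boldsymbol{u}_2}{1-\lambda}\Big\},$$ $$\boldsymbol{u}(\boldsymbol{\chi})=\min\Big\{\boldsymbol{u}_{\boldsymbol A}+\boldsymbol{\beta},\ \boldsymbol{u}_2,\ \frac{\boldsymbol{A}\boldsymbol{x}_1-\lambda\boldsymbol{\ell}_{\boldsymbol A}}{1-\lambda}+\boldsymbol{\beta},\ \frac{\boldsymbol{x}_2-\lambda\boldsymbol{\ell}_2}{1-\lambda}\Big\}.$$
   Context: Data: integers $d_x,d_y,d_z\ge1$; a diagonal matrix $\boldsymbol{Q}_2\in\mathbb{R}^{d_x\times d_x}$ with nonnegative entries; symmetric positive semidefinite $\boldsymbol{R}\in\mathbb{R}^{d_y\times d_y}$, $\boldsymbol{S}\in\mathbb{R}^{d_z\times d_z}$; $\boldsymbol{A}\in\mathbb{R}^{d_x\times d_x}$, $\boldsymbol{B}\in\mathbb{R}^{d_x\times d_y}$, $\boldsymbol{C}\in\mathbb{R}^{d_x\times d_z}$; $\boldsymbol{G},\boldsymbol{H}\in\mathbb{R}^{d_y\times d_z}$; $\boldsymbol{\ell}_1,\boldsymbol{u}_1,\boldsymbol{\ell}_2,\boldsymbol{u}_2\in\mathbb{R}^{d_x}$. Vector inequalities are componentwise; $\mathbf 1$ is an all-ones vector. The vectors $\boldsymbol{u}_{\boldsymbol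 A},\boldsymbol{\ell}_{\boldsymbol A}\in\mathbb{R}^{d_x}$ are the interval bounds for $\boldsymbol{A}\boldsymbol{x}_1$: $$(\boldsymbol{u}_{\boldsymbol A})_i=\sum_{j:A_{ij}>0}A_{ij}u_{1,j}+\sum_{k:A_{ik}<0}A_{ik}\ell_{1,k},\qquad(\boldsymbol{\ell}_{\boldsymbol A})_i=\sum_{j:A_{ij}>0}A_{ij}\ell_{1,j}+\sum_{k:A_{ik}<0}A_{ik}u_{1,k}.$$ Underlying single-period problem: mode vector $\boldsymbol{z}\in\{0,1\}^{d_z}$ with $\mathbf 1^\top\boldsymbol{z}\le1$ and control $\boldsymbol{y}\in\mathbb{R}^{d_y}$ with $\boldsymbol{G}\boldsymbol{z}\le\boldsymbol{y}\le\boldsymbol{H}\boldsymbol{z}$. With $J=\{1,\dots,d_y\}$, set $J_1=J\setminus\{j\in J: y_j=0\text{ whenever }z_k=0\ \forall k\in K_2\}$ and $J_2=J\setminus\{j\in J: y_j=0\text{ whenever }z_k=0\ \forall k\in K_1\}$ ($J_1,J_2$ need not partition $J$). In $( * )$ the vectors $\boldsymbol{y}_{J_1}$ and $\boldsymbol{y}_{J_2}$ are treated as separate variables. For $i=1,2$: $\boldsymbol{G}_{J_i},\boldsymbol{H}_{J_i}$ are the submatrices of $\boldsymbol{G},\boldsymbol{H}$ with rows $J_i$ and columns $K_i$; $\boldsymbol{B}_{J_i}$ consists of the columns of $\boldsymbol{B}$ indexed by $J_i$; $\boldsymbol{C}_{K_i}$ of the columns of $\boldsymbol{C}$ indexed by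 $K_i$; $\boldsymbol{R}_{J_i}$ and $\boldsymbol{S}_{K_i}$ are the principal submatrices of $\boldsymbol{R},\boldsymbol{S}$ indexed by $J_i$ and $K_i$. *)

(* Defs.v *)
From mathcomp Require Import all_boot all_order all_algebra.
From mathcomp Require Import boolp reals.

Set Implicit Arguments.
Unset Strict Implicit.
Unset Printing Implicit Defensive.

Import Order.TTheory GRing.Theory Num.Theory.
Local Open Scope ring_scope.

Definition lecv (R : realType) (n : nat) (u v : 'cV[R]_n) : Prop :=
  forall i, u i 0 <= v i 0.
Notation "u <=c v" := (lecv u v) (at level 70, no associativity) : ring_scope.

Definition quad (R : realType) (n : nat) (M : 'M[R]_n) (v : 'cV[R]_n) : R :=
  (v^T *m M *m v) 0 0.

Definition total (R : realType) (n : nat) (v : 'cV[R]_n) : R := \sum_i v i 0.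

Definition binary (R : realType) (n : nat) (v : 'cV[R]_n) : Prop :=
  forall i, v i 0 = 0 \/ v i 0 = 1.

Definition in_unit_box (R : realType) (n : nat) (v : 'cV[R]_n) : Prop :=
  forall i, 0 <= v i 0 <= 1.

Definition rows_cols (R : realType) (m n : nat) (I : {set 'I_m})
    (J : {set 'I_n}) (M : 'M[R]_(m, n)) : 'M[R]_(#|I|, #|J|) :=
  mxsub (fun i : 'I_#|I| => enum_val i) (fun j : 'I_#|J| => enum_val j) M.

Definition cols (R : realType) (m n : nat) (J : {set 'I_n})
    (M : 'M[R]_(m, n)) : 'M[R]_(m, #|J|) :=
  colsub (fun j : 'I_#|J| => enum_val j) M.

Record data (R : realType) (dx dy dz : nat) := Data {
  mQ2 : 'M[R]_dx;
  mR : 'M[R]_dy;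
  mS : 'M[R]_dz;
  mA : 'M[R]_dx;
  mB : 'M[R]_(dx, dy);
  mC : 'M[R]_(dx, dz);
  mG : 'M[R]_(dy, dz);
  mH : 'M[R]_(dy, dz);
  l1 : 'cV[R]_dx;
  u1 : 'cV[R]_dx;
  l2 : 'cV[R]_dx;
  u2 : 'cV[R]_dx;
  mQ2_diag : is_diag_mx mQ2;
  mQ2_ge0 : forall i j, 0 <= mQ2 i j;
  mR_sym : mR^T = mR;
  mR_psd : forall v, 0 <= quad mR v;
  mS_sym : mS^T = mS;
  mS_psd : forall v, 0 <= quad mS v
}.

Definition uA (R : realType) (dx dy dz : nat) (D : data R dx dy dz) :
    'cV[R]_dx :=
  \col_i (\sum_(j | 0 < mA D i j) mA D i j * u1 D j 0 +
          \sum_(k | mA D i k < 0) mA D i k * l1 D k 0).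

Definition lA (R : realType) (dx dy dz : nat) (D : data R dx dy dz) :
    'cV[R]_dx :=
  \col_i (\sum_(j | 0 < mA D i j) mA D i j * l1 D j 0 +
          \sum_(k | mA D i k < 0) mA D i k * u1 D k 0).

Definition mode_control (R : realType) (dx dy dz : nat) (D : data R dx dy dz)
    (z : 'cV[R]_dz) (y : 'cV[R]_dy) : Prop :=
  [/\ binary z, total z <= 1, mG D *m z <=c y & y <=c mH D *m z].

(* Controls that are not forced to 0 once all the modes in Koff are off. *)
Definition control_set (R : realType) (dx dy dz : nat) (D : data R dx dy dz)
    (Koff : {set 'I_dz}) : {set 'I_dy} :=
  [set: 'I_dy] :\: [set j | `[< forall z y, mode_control D z y ->
    (forall k, k \in Koff -> z k 0 = 0) -> y j 0 = 0 >]].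

Definition J1 (R : realType) (dx dy dz : nat) (D : data R dx dy dz)
    (K1 : {set 'I_dz}) : {set 'I_dy} := control_set D (~: K1).

Definition J2 (R : realType) (dx dy dz : nat) (D : data R dx dy dz)
    (K1 : {set 'I_dz}) : {set 'I_dy} := control_set D K1.

(* K2 is ~: K1 throughout. *)
Record point (R : realType) (dx dy dz : nat) (D : data R dx dy dz)
    (K1 : {set 'I_dz}) := Point {
  x1 : 'cV[R]_dx;
  x2 : 'cV[R]_dx;
  y1 : 'cV[R]_#|J1 D K1|;
  y2 : 'cV[R]_#|J2 D K1|;
  z1 : 'cV[R]_#|K1|;
  z2 : 'cV[R]_#|~: K1|
}.

Definition input1 (R : realType) (dx dy dz : nat) (D : data R dx dy dz)
    (K1 : {set 'I_dz}) (chi : point D K1) : 'cV[R]_dx :=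
  cols (J1 D K1) (mB D) *m y1 chi + cols K1 (mC D) *m z1 chi.

Definition input2 (R : realType) (dx dy dz : nat) (D : data R dx dy dz)
    (K1 : {set 'I_dz}) (chi : point D K1) : 'cV[R]_dx :=
  cols (J2 D K1) (mB D) *m y2 chi + cols (~: K1) (mC D) *m z2 chi.

Definition lambda (R : realType) (dx dy dz : nat) (D : data R dx dy dz)
    (K1 : {set 'I_dz}) (chi : point D K1) : R := total (z1 chi).

Record star (R : realType) (dx dy dz : nat) (D : data R dx dy dz)
    (K1 : {set 'I_dz}) (chi : point D K1) (w : R) : Prop := Star {
  star_cost : quad (mQ2 D) (x2 chi)
    + (quad (rows_cols (J1 D K1) (J1 D K1) (mR D)) (y1 chi)
       + quad (rows_cols K1 K1 (mS D)) (z1 chi))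
    + (quad (rows_cols (J2 D K1) (J2 D K1) (mR D)) (y2 chi)
       + quad (rows_cols (~: K1) (~: K1) (mS D)) (z2 chi)) <= w;
  star_dyn : x2 chi = mA D *m x1 chi
    + cols (J1 D K1) (mB D) *m y1 chi + cols (J2 D K1) (mB D) *m y2 chi
    + cols K1 (mC D) *m z1 chi + cols (~: K1) (mC D) *m z2 chi;
  star_y1l : rows_cols (J1 D K1) K1 (mG D) *m z1 chi <=c y1 chi;
  star_y1u : y1 chi <=c rows_cols (J1 D K1) K1 (mH D) *m z1 chi;
  star_y2l : rows_cols (J2 D K1) (~: K1) (mG D) *m z2 chi <=c y2 chi;
  star_y2u : y2 chi <=c rows_cols (J2 D K1) (~: K1) (mH D) *m z2 chi;
  star_x1l : l1 D <=c x1 chi;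
  star_x1u : x1 chi <=c u1 D;
  star_x2l : l2 D <=c x2 chi;
  star_x2u : x2 chi <=c u2 D;
  star_modes : total (z1 chi) + total (z2 chi) <= 1
}.

Record cuts (R : realType) (dx dy dz : nat) (D : data R dx dy dz)
    (K1 : {set 'I_dz}) (chi : point D K1) : Prop := Cuts {
  cutA : (1 - lambda chi) *: lA D + input2 chi <=c (1 - lambda chi) *: u2 D;
  cutB : (1 - lambda chi) *: l2 D <=c (1 - lambda chi) *: uA D + input2 chi;
  cutC : (1 - lambda chi) *: lA D + input2 chi <=c x2 chi - lambda chi *: l2 D;
  cutD : x2 chi - input2 chi <=c lambda chi *: u2 D + (1 - lambda chi) *: uA D;
  cutE : lambda chi *: lA D + (1 - lambda chi) *: l2 D
    <=c mA D *m x1 chi + input2 chi;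
  cutF : mA D *m x1 chi + input2 chi
    <=c lambda chi *: uA D + (1 - lambda chi) *: u2 D;
  cutG : input1 chi + lambda chi *: lA D <=c lambda chi *: u2 D;
  cutH : lambda chi *: l2 D <=c input1 chi + lambda chi *: uA D
}.

Definition beta (R : realType) (dx dy dz : nat) (D : data R dx dy dz)
    (K1 : {set 'I_dz}) (chi : point D K1) : 'cV[R]_dx :=
  (1 - lambda chi)^-1 *: input2 chi.

Definition maxcv (R : realType) (n : nat) (u v : 'cV[R]_n) : 'cV[R]_n :=
  \col_i Num.max (u i 0) (v i 0).

Definition mincv (R : realType) (n : nat) (u v : 'cV[R]_n) : 'cV[R]_n :=
  \col_i Num.min (u i 0) (v i 0).

Definition lchi (R : realType) (dx dy dz : nat) (D : data R dx dy dz)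
    (K1 : {set 'I_dz}) (chi : point D K1) : 'cV[R]_dx :=
  let lam := lambda chi in
  maxcv (lA D + beta chi)
 (maxcv (l2 D)
 (maxcv ((1 - lam)^-1 *: (mA D *m x1 chi - lam *: uA D) + beta chi)
        ((1 - lam)^-1 *: (x2 chi - lam *: u2 D)))).

Definition uchi (R : realType) (dx dy dz : nat) (D : data R dx dy dz)
    (K1 : {set 'I_dz}) (chi : point D K1) : 'cV[R]_dx :=
  let lam := lambda chi in
  mincv (uA D + beta chi)
 (mincv (u2 D)
 (mincv ((1 - lam)^-1 *: (mA D *m x1 chi - lam *: lA D) + beta chi)
        ((1 - lam)^-1 *: (x2 chi - lam *: l2 D)))).

Record min_problem (R : realType) (T : Type) := MinProblem {
  objective : T -> R;
  admissible : T -> Prop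
}.

Definition feasible (R : realType) (T : Type) (P : min_problem R T) : Prop :=
  exists s, admissible P s.

(* As the terms share no variable, the sum over i of the minima over sigma_i is
   the minimum of the sum over the vector (sigma_i)_i. *)
Definition sigma_problem (R : realType) (dx dy dz : nat)
    (D : data R dx dy dz) (K1 : {set 'I_dz}) (chi : point D K1) :
    min_problem R 'cV[R]_dx :=
  {| objective := fun s : 'cV[R]_dx =>
       \sum_i mQ2 D i i * (x2 chi i 0 - s i 0) ^+ 2;
     admissible := fun s : 'cV[R]_dx =>
       forall i, lchi chi i 0 <= s i 0 <= uchi chi i 0 |}.

(* Main.v *)
Require Import Defs.
From mathcomp Require Import all_boot all_order all_algebra.
From mathcomp Require Import boolp reals.
From mathcomp Require Import ring lra.
Import Order.TTheory GRing.Theory Num.Theory.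
Local Open Scope ring_scope.

Set Implicit Arguments.
Unset Strict Implicit.
Unset Printing Implicit Defensive.

(** Everything happens coordinate by coordinate, and rests on the dynamics
    [x2 = A x1 + input1 + input2] together with the two boxes
    [lA <= A x1 <= uA] (interval arithmetic, [lA_le] and [le_uA]) and
    [l2 <= x2 <= u2].

    For binary modes, [z1] is either zero or a unit vector, so [lambda] is 0
    or 1.  If [lambda = 0] the modes [z1] vanish, hence so do the controls
    squeezed between [G z1] and [H z1], and [input1 = 0]; if [lambda = 1] the
    mode budget leaves nothing for [z2], and [input2 = 0]
    ([star_binary_cases]).  In both cases [x2] and [A x1] differ by the single
    remaining input, and each cut collapses to [0 <= 0] or to a chain of box
    inequalities, such as [lA + input2 <= A x1 + input2 = x2 <= u2] for the
    first cut at [lambda = 0].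

    For fractional modes with [lambda < 1], an admissible sigma exists as soon
    as each of the four lower bounds lies below each of the four upper bounds.
    After multiplication by [1 - lambda > 0] these sixteen inequalities are
    affine: the eight cuts give eight of them, one each, and the other eight
    follow from the two boxes and [0 <= lambda] ([lchi_le_uchi]). *)

(** Every term of [sum_j a j * x j] is maximal at the end of [[l j, u j]]
    selected by the sign of [a j]. *)
Lemma sum_interval_ub (R : realType) (n : nat) (a x l u : 'I_n -> R) :
  (forall j, l j <= x j <= u j) ->
  \sum_j a j * x j
    <= \sum_(j | 0 < a j) a j * u j + \sum_(j | a j < 0) a j * l j.
Proof.
move=> xlu; rewrite (big_mkcond (fun j => 0 < a j)).
rewrite (big_mkcond (fun j => a j < 0)) -big_split /=.
apply: ler_sum => j _; have /andP[lx xu] := xlu j.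
have [a_gt0|a_lt0|<-] := ltgtP 0 (a j).
- by rewrite addr0 ler_wpM2l // ltW.
- by rewrite add0r ler_wnM2l // ltW.
- by rewrite mul0r addr0.
Qed.

(** The reflection [x |-> - x] exchanges the roles of the two bounds. *)
Lemma sum_interval_lb (R : realType) (n : nat) (a x l u : 'I_n -> R) :
  (forall j, l j <= x j <= u j) ->
  \sum_(j | 0 < a j) a j * l j + \sum_(j | a j < 0) a j * u j
    <= \sum_j a j * x j.
Proof.
move=> xlu; rewrite -lerN2 opprD -!sumrN.
have /(sum_interval_ub a) : forall j, - u j <= - x j <= - l j.
  by move=> j; rewrite !lerN2 andbC.
by under eq_bigr do rewrite mulrN; under [X in _ <= X + _]eq_bigr do
  rewrite mulrN; under [X in _ <= _ + X]eq_bigr do rewrite mulrN.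
Qed.

Lemma le_uA (R : realType) (dx dy dz : nat) (D : data R dx dy dz)
    (x : 'cV[R]_dx) : l1 D <=c x -> x <=c u1 D -> mA D *m x <=c uA D.
Proof.
move=> lx xu i; rewrite !mxE.
apply: (@sum_interval_ub _ _ _ (x^~ 0) ((l1 D)^~ 0) ((u1 D)^~ 0)) => j.
by rewrite lx xu.
Qed.

Lemma lA_le (R : realType) (dx dy dz : nat) (D : data R dx dy dz)
    (x : 'cV[R]_dx) : l1 D <=c x -> x <=c u1 D -> lA D <=c mA D *m x.
Proof.
move=> lx xu i; rewrite !mxE.
apply: (@sum_interval_lb _ _ _ (x^~ 0) ((l1 D)^~ 0) ((u1 D)^~ 0)) => j.
by rewrite lx xu.
Qed.

Lemma binary_ge0 (R : realType) (n : nat) (v : 'cV[R]_n) :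
  binary v -> forall i, 0 <= v i 0.
Proof. by move=> vb i; case: (vb i) => ->. Qed.

Lemma total_ge0 (R : realType) (n : nat) (v : 'cV[R]_n) :
  (forall i, 0 <= v i 0) -> 0 <= Defs.total v.
Proof. by move=> v_ge0; apply: sumr_ge0. Qed.

Lemma total_le0_eq0 (R : realType) (n : nat) (v : 'cV[R]_n) :
  (forall i, 0 <= v i 0) -> Defs.total v <= 0 -> v = 0.
Proof.
move=> v_ge0 tv; have /eqP tv0 : Defs.total v == 0.
  by rewrite eq_le tv total_ge0.
apply/colP => i; rewrite mxE.
by apply: (psumr_eq0P _ tv0) => // j _; apply: v_ge0.
Qed.

(** A single entry 1 already exhausts the budget. *)
Lemma binary_total_le1 (R : realType) (n : nat) (v : 'cV[R]_n) :
  binary v -> Defs.total v <= 1 -> v = 0 \/ Defs.total v = 1.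
Proof.
move=> vb tv1; have [[i vi1]|no1] := pselect (exists i, v i 0 = 1).
  right; apply/eqP; rewrite eq_le tv1 /Defs.total (bigD1 i) //= vi1 lerDl.
  by apply: sumr_ge0 => j _; apply: binary_ge0.
left; apply/colP => i; rewrite mxE.
by case: (vb i) => // vi1; case: no1; exists i.
Qed.

(** Switching all the modes off forces the squeezed controls to 0. *)
Lemma control_eq0 (R : realType) (m n : nat) (G H : 'M[R]_(m, n))
    (y : 'cV[R]_m) : G *m 0 <=c y -> y <=c H *m 0 -> y = 0.
Proof.
rewrite !mulmx0 => y_ge0 y_le0; apply/colP => i; apply/eqP.
by rewrite eq_le y_ge0 y_le0.
Qed.

Lemma addcvE (R : realType) (n : nat) (u v : 'cV[R]_n) i :
  (u + v) i 0 = u i 0 + v i 0.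
Proof. exact: mxE. Qed.

Lemma oppcvE (R : realType) (n : nat) (u : 'cV[R]_n) i :
  (- u) i 0 = - u i 0.
Proof. exact: mxE. Qed.

Lemma scalecvE (R : realType) (n : nat) (a : R) (u : 'cV[R]_n) i :
  (a *: u) i 0 = a * u i 0.
Proof. exact: mxE. Qed.

Lemma zerocvE (R : realType) (n : nat) i : (0 : 'cV[R]_n) i 0 = 0.
Proof. exact: mxE. Qed.

Lemma maxcvE (R : realType) (n : nat) (u v : 'cV[R]_n) i :
  maxcv u v i 0 = Num.max (u i 0) (v i 0).
Proof. exact: mxE. Qed.

Lemma mincvE (R : realType) (n : nat) (u v : 'cV[R]_n) i :
  mincv u v i 0 = Num.min (u i 0) (v i 0).
Proof. exact: mxE. Qed.

(** Unlike [mxE], this leaves matrix products folded, so that the entries of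
    [A x1] remain atoms for the linear arithmetic. *)
Definition cvE := (addcvE, oppcvE, scalecvE, zerocvE, maxcvE, mincvE).

Lemma star_x2E (R : realType) (dx dy dz : nat) (D : data R dx dy dz)
    (K1 : {set 'I_dz}) (chi : point D K1) (w : R) (i : 'I_dx) :
  star chi w ->
  x2 chi i 0 = (mA D *m x1 chi) i 0 + input1 chi i 0 + input2 chi i 0.
Proof.
by move=> chi_star; rewrite (star_dyn chi_star) !cvE; ring.
Qed.

Lemma star_input1_eq0 (R : realType) (dx dy dz : nat) (D : data R dx dy dz)
    (K1 : {set 'I_dz}) (chi : point D K1) (w : R) :
  star chi w -> z1 chi = 0 -> input1 chi = 0.
Proof.
move=> chi_star z0; have := star_y1u chi_star; have := star_y1l chi_star.
by rewrite /input1 z0 => yl /(control_eq0 yl) ->; rewrite !mulmx0 addr0.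
Qed.

Lemma star_input2_eq0 (R : realType) (dx dy dz : nat) (D : data R dx dy dz)
    (K1 : {set 'I_dz}) (chi : point D K1) (w : R) :
  star chi w -> z2 chi = 0 -> input2 chi = 0.
Proof.
move=> chi_star z0; have := star_y2u chi_star; have := star_y2l chi_star.
by rewrite /input2 z0 => yl /(control_eq0 yl) ->; rewrite !mulmx0 addr0.
Qed.

(** The alternative behind all the cuts: either the first group of modes is
    inactive, or it uses up the whole budget and the second one is inactive. *)
Lemma star_binary_cases (R : realType) (dx dy dz : nat) (D : data R dx dy dz)
    (K1 : {set 'I_dz}) (chi : point D K1) (w : R) :
  star chi w -> binary (z1 chi) -> binary (z2 chi) ->
  lambda chi = 0 /\ input1 chi = 0 \/ lambda chi = 1 /\ input2 chi = 0.
Proof.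
move=> chi_star b1 b2; have budget := star_modes chi_star.
have t2_ge0 := total_ge0 (binary_ge0 b2).
have t1_le1 : Defs.total (z1 chi) <= 1 by lra.
have [z0|t1] := binary_total_le1 b1 t1_le1.
  left; split; last exact: star_input1_eq0 chi_star z0.
  by rewrite /lambda z0 /Defs.total big1 // => i _; rewrite mxE.
right; split => //; apply: star_input2_eq0 chi_star _.
by apply: total_le0_eq0 (binary_ge0 b2) _; lra.
Qed.

Lemma star_cuts (R : realType) (dx dy dz : nat) (D : data R dx dy dz)
    (K1 : {set 'I_dz}) (chi : point D K1) (w : R) :
  star chi w -> binary (z1 chi) -> binary (z2 chi) -> cuts chi.
Proof.
move=> chi_star b1 b2.
have lAx := lA_le (star_x1l chi_star) (star_x1u chi_star).
have xuA := le_uA (star_x1l chi_star) (star_x1u chi_star).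
have lx2 := star_x2l chi_star; have x2u := star_x2u chi_star.
have [[lam in0]|[lam in0]] := star_binary_cases chi_star b1 b2; split=> i;
  move: (lAx i) (xuA i) (lx2 i) (x2u i) (star_x2E i chi_star);
  rewrite lam in0 !cvE; lra.
Qed.

Lemma lchiE (R : realType) (dx dy dz : nat) (D : data R dx dy dz)
    (K1 : {set 'I_dz}) (chi : point D K1) (i : 'I_dx) : lambda chi < 1 ->
  let m := 1 - lambda chi in let in2 := input2 chi i 0 in
  lchi chi i 0 = m^-1 *
    Num.max (m * lA D i 0 + in2) (Num.max (m * l2 D i 0)
    (Num.max ((mA D *m x1 chi) i 0 - lambda chi * uA D i 0 + in2)
             (x2 chi i 0 - lambda chi * u2 D i 0))).
Proof.
rewrite -subr_gt0 => m_gt0 /=; have m_neq0 := lt0r_neq0 m_gt0.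
by rewrite !maxr_pMr ?invr_ge0 ?ltW // !cvE !mulrDr !mulKf.
Qed.

Lemma uchiE (R : realType) (dx dy dz : nat) (D : data R dx dy dz)
    (K1 : {set 'I_dz}) (chi : point D K1) (i : 'I_dx) : lambda chi < 1 ->
  let m := 1 - lambda chi in let in2 := input2 chi i 0 in
  uchi chi i 0 = m^-1 *
    Num.min (m * uA D i 0 + in2) (Num.min (m * u2 D i 0)
    (Num.min ((mA D *m x1 chi) i 0 - lambda chi * lA D i 0 + in2)
             (x2 chi i 0 - lambda chi * l2 D i 0))).
Proof.
rewrite -subr_gt0 => m_gt0 /=; have m_neq0 := lt0r_neq0 m_gt0.
by rewrite !minr_pMr ?invr_ge0 ?ltW // !cvE !mulrDr !mulKf.
Qed.

(** Once the common factor [(1 - lambda)^-1] is removed, the bounds are affine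
    in the data of the cuts, so comparing them is linear arithmetic. *)
Lemma lchi_le_uchi (R : realType) (dx dy dz : nat) (D : data R dx dy dz)
    (K1 : {set 'I_dz}) (chi : point D K1) (w : R) :
  star chi w -> 0 <= lambda chi -> lambda chi < 1 -> cuts chi ->
  lchi chi <=c uchi chi.
Proof.
move=> chi_star lam_ge0 lam_lt1 chi_cuts i.
have m_gt0 : 0 < 1 - lambda chi by rewrite subr_gt0.
rewrite lchiE // uchiE // ler_pM2l ?invr_gt0 //.
have lAx := lA_le (star_x1l chi_star) (star_x1u chi_star) i.
have xuA := le_uA (star_x1l chi_star) (star_x1u chi_star) i.
have lx2 := star_x2l chi_star i; have x2u := star_x2u chi_star i.
(* Linear arithmetic treats products such as [lambda * uA] as atoms, so the
   boxes have to be supplied already multiplied by the two weights. *)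
have lam_A := ler_wpM2l lam_ge0 (le_trans lAx xuA).
have lam_2 := ler_wpM2l lam_ge0 (le_trans lx2 x2u).
have m_A := ler_wpM2l (ltW m_gt0) (le_trans lAx xuA).
have m_2 := ler_wpM2l (ltW m_gt0) (le_trans lx2 x2u).
case: chi_cuts (star_x2E i chi_star) => /(_ i) + /(_ i) + /(_ i) +
  /(_ i) + /(_ i) + /(_ i) + /(_ i) + /(_ i) +; rewrite !cvE => cA cB cC cD cE cF cG cH x2E.
rewrite !ge_max !le_min; do ![apply/andP; split]; lra.
Qed.

Theorem proposition9 (R : realType) (dx dy dz : nat)
    (hdx : (1 <= dx)%N) (hdy : (1 <= dy)%N) (hdz : (1 <= dz)%N)
    (D : data R dx dy dz) (K1 : {set 'I_dz}) :
  (forall (chi : point D K1) (w : R),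
      star chi w -> binary (z1 chi) -> binary (z2 chi) -> cuts chi) /\
  (forall (chi : point D K1) (w : R),
      star chi w -> in_unit_box (z1 chi) -> in_unit_box (z2 chi) ->
      cuts chi -> lambda chi < 1 -> feasible (sigma_problem chi)).
Proof.
split=> [chi w|chi w chi_star z1_box _ chi_cuts lam_lt1]; first exact: star_cuts.
exists (lchi chi) => i; rewrite lexx /=.
have lam_ge0 : 0 <= lambda chi.
  by apply: total_ge0 => k; have /andP[] := z1_box k.
exact: (lchi_le_uchi chi_star lam_ge0 lam_lt1 chi_cuts).
Qed.
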